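(* Let $p\ge1$, $q>0$, $s>\max\{0,1-\frac qn\}$. There is a constant $C>0$, independent of $r$, such that for every $0\le r<1$ and every $f\in H(\mathbb{B})$, $$\|f_r\|\le\begin{cases}C\,|f|_{\frac qp}\cdot\dfrac1{(1-r^2)^{\frac qp}}, & s>1,\\[2mm] C\,|f|_{\frac qp}\cdot\dfrac1{(1-r^2)^{\frac{2(n+1-ns)}p}}, & s\le1.\end{cases}$$
   Context: $\mathbb{B}$ is the open unit ball of $\mathbb{C}^n$, $H(\mathbb{B})$ is the space of holomorphic functions on $\mathbb{B}$, $dV$ is normalized volume measure on $\mathbb{B}$, and $d\lambda(z)=\frac{dV(z)}{(1-|z|^2)^{n+1}}$. For $a\in\mathbb{B}$, $\Phi_a(z)=\frac{a-P_az-s_aQ_az}{1-\langle z,a\rangle}$, where $s_a=\sqrt{1-|a|^2}$, $P_a$ is the orthogonal projection onto the span of $a$ and $Q_a=I-P_a$. For $f\in H(\mathbb{B})$, $\|f\|^p=\sup_{a\in\mathbb{B}}\int_{\mathbb{B}}|f(z)|^p(1-|z|^2)^q(1-|\Phi_a(z)|^2)^{ns}d\lambda(z)$ (the $\mathcal{N}(p,q,s)$-norm), $|f|_l=\sup_{z\in\mathbb{B}}|f(z)|(1-|z|^2)^l$ for $l>0$ (possibly infinite), and $f_r(z)=f(rz)$. *)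

(* Defs.v *)
From HB Require Import structures.
From mathcomp Require Import all_boot all_order all_algebra.
From mathcomp Require Import all_classical all_reals all_analysis.
From mathcomp.real_closed Require Import complex.

Set Implicit Arguments.
Unset Strict Implicit.
Unset Printing Implicit Defensive.

Import Order.TTheory GRing.Theory Num.Theory.
Import numFieldNormedType.Exports.

Local Open Scope classical_set_scope.
Local Open Scope ring_scope.
Local Open Scope complex_scope.

Notation plane R := (measurableTypeR R * measurableTypeR R)%type.

(* [product_measure1] of two sigma-finite measures under a name of its own:
   the library infers sigma-finiteness of [\x] only for subprobabilities. *)
Section sigma_finite_product.
Local Open Scope ereal_scope.
Context d1 d2 (T1 : measurableType d1) (T2 : measurableType d2) (R : realType).
Variables (m1 : {sigma_finite_measure set T1 -> \bar R})
          (m2 : {sigma_finite_measure set T2 -> \bar R}).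

Definition sfprod : set (T1 * T2) -> \bar R := m1 \x m2.

HB.instance Definition _ := Measure.on sfprod.

Let sfprod_sigma_finite : sigma_finite setT sfprod.
Proof.
have /sigma_finiteP[F [TF ndF Foo]] := sigma_finiteT m1.
have /sigma_finiteP[G [TG ndG Goo]] := sigma_finiteT m2.
exists (fun n => F n `*` G n).
  rewrite -setXTT TF TG predeqE => -[x y]; split.
    move=> [/= [n _ Fnx] [k _ Gky]]; exists (maxn n k) => //; split.
    - by move: x Fnx; exact/subsetPset/ndF/leq_maxl.
    - by move: y Gky; exact/subsetPset/ndG/leq_maxr.
  by move=> [n _ []/= ? ?]; split; exists n.
move=> k; have [? ?] := Foo k; have [? ?] := Goo k.
split; first exact: measurableX.
by rewrite /sfprod product_measure1E// lte_mul_pinfty// ge0_fin_numE.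
Qed.

HB.instance Definition _ := Measure_isSigmaFinite.Build _ _ _ sfprod
  sfprod_sigma_finite.

End sigma_finite_product.

Section volume.
Variable R : realType.

Definition plane_volume : {sigma_finite_measure set (plane R) -> \bar R} :=
  sfprod (@lebesgue_measure R) (@lebesgue_measure R).

Section step.
Variable n : nat.

Definition tcons (x : plane R * n.-tuple (plane R)) : n.+1.-tuple (plane R) :=
  [tuple of x.1 :: x.2].

Lemma measurable_tcons : measurable_fun setT tcons.
Proof. by apply: measurable_cons. Qed.

Let tuncons (x : n.+1.-tuple (plane R)) : plane R * n.-tuple (plane R) :=
  (thead x, [tuple of behead x]).

Let measurable_tuncons : measurable_fun setT tuncons.
Proof.
apply: measurable_fun_pair; last exact: measurable_behead.
exact: measurable_tnth.
Qed.

Variable mu : {sigma_finite_measure set (n.-tuple (plane R)) -> \bar R}.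

Definition volume_step : set (n.+1.-tuple (plane R)) -> \bar R :=
  pushforward (sfprod plane_volume mu) tcons.

HB.instance Definition _ := Measure.copy volume_step
  (measure_function_pushforward__canonical__measure_function_Measure
     (sfprod plane_volume mu) measurable_tcons).

Let volume_step_sigma_finite : sigma_finite setT volume_step.
Proof.
have [F FT Foo] := sigma_finiteT (sfprod plane_volume mu).
exists (fun k => tuncons @^-1` F k).
  by rewrite -preimage_bigcup -FT preimage_setT.
move=> k; have [mF Fk] := Foo k; split.
  by rewrite -[X in measurable X]setTI; exact: measurable_tuncons.
rewrite /volume_step /pushforward -comp_preimage.
rewrite (_ : _ \o _ = id)//.
by apply/funext => -[x t]; congr pair; apply/val_inj.
Qed.

HB.instance Definition _ := Measure_isSigmaFinite.Build _ _ _ volume_step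
  volume_step_sigma_finite.

End step.

(* Lebesgue measure on (R^2)^n. *)
Fixpoint volume (n : nat)
    : {sigma_finite_measure set (n.-tuple (plane R)) -> \bar R} :=
  match n with
  | 0 => @dirac _ _ [tuple] R
  | m.+1 => volume_step (volume m)
  end.

End volume.

Section ball.
Variables (R : realType) (n : nat).
Implicit Types (a z w : 'rV[R[i]]_n) (f : 'rV[R[i]]_n -> R[i]).

Definition cdot z w : R[i] := \sum_j z 0 j * (w 0 j)^*.

Definition enorm z : R := Num.sqrt (\sum_j Normc.normc (z 0 j) ^+ 2).

Definition unit_ball : set 'rV[R[i]]_n := [set z | enorm z < 1].

(* Complex Frechet differentiability; the sup norm that ['rV[R[i]]_n] carries
   in the library is equivalent to [enorm]. Values of [f] off the ball are
   irrelevant everywhere below. *)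
Definition holomorphic f : Prop :=
  forall z : ('rV[R[i]]_n : normedModType R[i]),
    unit_ball z -> differentiable (f : 'rV[R[i]]_n -> R[i]^o) z.

(* For [a = 0] this is [0], as [_ / 0 = 0]. *)
Definition projP a z : 'rV[R[i]]_n := (cdot z a / cdot a a) *: a.

Definition projQ a z : 'rV[R[i]]_n := z - projP a z.

Definition Phi a z : 'rV[R[i]]_n :=
  (1 - cdot z a)^-1 *:
    (a - projP a z - (Num.sqrt (1 - enorm a ^+ 2))%:C *: projQ a z).

(* C^n is identified with (R^2)^n through the real and imaginary parts. *)
Definition cpoint (x : n.-tuple (plane R)) : 'rV[R[i]]_n :=
  \row_j ((tnth x j).1 +i* (tnth x j).2).

Definition coord_ball : set (n.-tuple (plane R)) := cpoint @^-1` unit_ball.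

(* Total mass 1 on [coord_ball]. *)
Definition dV : {measure set (n.-tuple (plane R)) -> \bar R} :=
  mscale (NngNum (fine_ge0 (measure_ge0 (volume R n) coord_ball)))%:num^-1%:nng
    (volume R n).

Definition dlambda_integral (g : 'rV[R[i]]_n -> R) : \bar R :=
  (\int[dV]_(x in coord_ball)
     (g (cpoint x) / (1 - enorm (cpoint x) ^+ 2) ^+ n.+1)%:E)%E.

Definition N_integral (p q s : R) f a : \bar R :=
  dlambda_integral (fun z =>
    Normc.normc (f z) `^ p * (1 - enorm z ^+ 2) `^ q
      * (1 - enorm (Phi a z) ^+ 2) `^ (n%:R * s)).

Definition N_norm (p q s : R) f : \bar R :=
  (ereal_sup [set N_integral p q s f a | a in unit_ball] `^ p^-1)%E.

Definition growth_norm (l : R) f : \bar R :=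
  ereal_sup [set (Normc.normc (f z) * (1 - enorm z ^+ 2) `^ l)%:E | z in unit_ball].

Definition dilate (r : R) f : 'rV[R[i]]_n -> R[i] := fun z => f (r%:C *: z).

End ball.

(* Main.v *)
Require Import Defs.
From HB Require Import structures.
From mathcomp Require Import all_boot all_order all_algebra.
From mathcomp Require Import all_classical all_reals all_analysis.
From mathcomp.real_closed Require Import complex.
From mathcomp Require Import measurable_realfun ring lra.

(** Write rho(z) = 1 - |z|^2, delta = 1 - |a|^2, D(z) = |1 - <z,a>|, t = 1 - r^2,
    g = n s, and let M be the growth norm of f. At the point r z it yields
    |f(r z)|^p <= M^p (1 - r^2 |z|^2)^(-q), and 1 - r^2 |z|^2 is at least rho(z)
    and at least t. Hence, for every exponent 0 <= e <= q,
      |f(r z)|^p rho^q <= M^p (rho / t)^e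
    ([growth_dilate_weight]). With 1 - |Phi_a(z)|^2 = delta rho / D^2
    ([one_sub_sqr_Phi]) the theorem is reduced to the bound, uniform in a,
      int rho^e (delta rho / D^2)^g rho^(-n-1) dV <= K   if e + g > n
    ([kernel_integral]). The choice e = q gives the estimate for s > 1, and
    e = min (q, 2 (n + 1 - n s)) gives the one for s <= 1, because t <= 1.

    The integral is estimated without unitary changes of variables. The
    elementary identity |z - a|^2 + rho + delta = 2 Re (1 - <z,a>) shows that
    both rho and delta are at most 2 D, and D is bounded. So every z in the ball
    lies in some set
      { D < h, rho < k },  h = delta 2^l,  k = 2 h / 2^i,  l, i >= 0,
    on which D is comparable to h and rho to k ([kernel_dyadic]). These truncated
    nonisotropic balls have volume at most C h^n k ([volume_nonisoball]); the
    product of this volume with the size of the kernel there is at most a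
    constant times 2^(- g l) 2^(- (e + g - n) i), whose double sum converges
    ([integral_le_double_cover]).

    The volume estimate is a Fubini argument. The same identity gives
    |z - a|^2 < 2 h, so all coordinates of z but one lie in squares of area
    8 h. If k <= 1/2, some coordinate z_j stays away from 0; when h is small a_j
    stays away from 0 as well, so the other coordinates and D < h confine z_j to
    a square of side of order h, inside the annulus 1 - k < |z|^2 < 1: an area
    of order h k ([area_annulus_piece]). If k > 1/2 then h is bounded below and
    the volume of a cube is a sufficient bound. *)

Set Implicit Arguments.
Unset Strict Implicit.
Unset Printing Implicit Defensive.

Import Order.TTheory GRing.Theory Num.Theory.
Import numFieldNormedType.Exports.

Local Open Scope classical_set_scope.
Local Open Scope ring_scope.

Local Notation cpoint := (@Defs.cpoint _ _).

(** * Measures of sets with small sections *)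

Section product_sections.
Local Open Scope ereal_scope.
Context d1 d2 (T1 : measurableType d1) (T2 : measurableType d2) (R : realType).
Variables (m1 : {sigma_finite_measure set T1 -> \bar R})
          (m2 : {sigma_finite_measure set T2 -> \bar R}).

Lemma sfprod_le_xsection (A : set (T1 * T2)) (E : set T1) (c : \bar R) :
    measurable A -> measurable E -> (forall u, A u -> E u.1) -> 0 <= c ->
    (forall x, m2 (xsection A x) <= c) ->
  sfprod m1 m2 A <= c * m1 E.
Proof.
move=> mA mE AE c0 Ac.
have -> : c * m1 E = \int[m1]_x (c * (\1_E x)%:E).
  rewrite ge0_integralZl//; last first.
    by apply/measurable_EFinP; exact: measurable_indic.
  by rewrite integral_indic// setIT.
rewrite /sfprod /product_measure1; apply: ge0_le_integral => //=.
- exact: measurable_fun_xsection.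
- apply: measurable_funeM; apply/measurable_EFinP; exact: measurable_indic.
move=> x _; rewrite indicE; have [xE|xE] := boolP (x \in E).
  by rewrite mule1.
rewrite mule0 (_ : xsection A x = set0) ?measure0//.
apply/seteqP; split => // y; rewrite /xsection/= inE => /AE/= Ex.
by move/negP: xE; apply; rewrite inE.
Qed.

Lemma sfprod_le_ysection (A : set (T1 * T2)) (E : set T2) (c : \bar R) :
    measurable A -> measurable E -> (forall u, A u -> E u.2) -> 0 <= c ->
    (forall y, m1 (ysection A y) <= c) ->
  sfprod m1 m2 A <= c * m2 E.
Proof.
move=> mA mE AE c0 Ac.
have -> : sfprod m1 m2 A = (m1 \x^ m2) A.
  by apply: product_measure_unique => //= *; rewrite product_measure2E.
have -> : c * m2 E = \int[m2]_x (c * (\1_E x)%:E).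
  rewrite ge0_integralZl//; last first.
    by apply/measurable_EFinP; exact: measurable_indic.
  by rewrite integral_indic// setIT.
rewrite /product_measure2; apply: ge0_le_integral => //=.
- exact: measurable_fun_ysection.
- apply: measurable_funeM; apply/measurable_EFinP; exact: measurable_indic.
move=> x _; rewrite indicE; have [xE|xE] := boolP (x \in E).
  by rewrite mule1.
rewrite mule0 (_ : ysection A x = set0) ?measure0//.
apply/seteqP; split => // y; rewrite /ysection/= inE => /AE/= Ex.
by move/negP: xE; apply; rewrite inE.
Qed.

End product_sections.

Section volume_sections.
Variable R : realType.

Definition tuple_set n (x : n.-tuple (plane R)) (j : 'I_n) (w : plane R) :
    n.-tuple (plane R) :=
  [tuple if k == j then w else tnth x k | k < n].

Lemma volumeS n (A : set (n.+1.-tuple (plane R))) :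
  volume R n.+1 A = sfprod (plane_volume R) (volume R n) (@tcons R n @^-1` A).
Proof. by []. Qed.

Lemma tnth_tconsS n w (t : n.-tuple (plane R)) (k : 'I_n) :
  tnth (tcons (w, t)) (lift ord0 k) = tnth t k.
Proof. by rewrite /tcons tnthS. Qed.

Lemma tuple_set_tcons0 n w v (t : n.-tuple (plane R)) :
  tuple_set (tcons (w, t)) ord0 v = tcons (v, t).
Proof.
apply: eq_from_tnth => i; rewrite tnth_mktuple.
case: (unliftP ord0 i) => [k ->|->].
  by rewrite !tnth_tconsS.
by rewrite eqxx.
Qed.

Lemma tuple_set_tconsS n w v (t : n.-tuple (plane R)) (j : 'I_n) :
  tuple_set (tcons (w, t)) (lift ord0 j) v = tcons (w, tuple_set t j v).
Proof.
apply: eq_from_tnth => i; rewrite tnth_mktuple.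
case: (unliftP ord0 i) => [k ->|->].
  by rewrite !tnth_tconsS tnth_mktuple (inj_eq lift_inj).
by rewrite (negPf (neq_lift _ _)).
Qed.

Definition tbox n (E : 'I_n -> set (plane R)) : set (n.-tuple (plane R)) :=
  [set x | forall k, E k (tnth x k)].

Lemma measurable_tbox n (E : 'I_n -> set (plane R)) :
  (forall k, measurable (E k)) -> measurable (tbox E).
Proof.
move=> mE.
rewrite (_ : tbox E = \bigcap_(k in [set: 'I_n]) ((@tnth _ _)^~ k @^-1` E k)).
  apply: fin_bigcap_measurable => // k _.
  by rewrite -[X in measurable X]setTI; exact: measurable_tnth.
by apply/seteqP; split => x; [move=> Ex k _; exact: Ex | move=> Ex k; exact: Ex].
Qed.

Lemma volume_tbox n (E : 'I_n -> set (plane R)) (b : R) :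
    0 <= b -> (forall k, measurable (E k)) ->
    (forall k, plane_volume R (E k) <= b%:E)%E ->
  (volume R n (tbox E) <= (b ^+ n)%:E)%E.
Proof.
move=> b0; elim: n E => [|n IH] E mE Eb.
  by rewrite expr0/= diracE lee_fin; case: (_ \in _).
rewrite volumeS (_ : _ @^-1` _ = E ord0 `*` tbox (E \o lift ord0)).
  rewrite /sfprod product_measure1E//; last by apply: measurable_tbox => k; exact: mE.
  rewrite exprS EFinM; apply: lee_pmul => //.
    exact: Eb.
  by apply: IH => k; [exact: mE|exact: Eb].
apply/seteqP; split => -[w t] /=.
  move=> H; split; first exact: (H ord0).
  by move=> k /=; have := H (lift ord0 k); rewrite tnth_tconsS.
move=> [/= H0 HS] k; case: (unliftP ord0 k) => [i ->|->] //.
by rewrite tnth_tconsS; exact: HS.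
Qed.

(** Fubini with respect to the j-th coordinate. Peeling off the first coordinate
    is the only splitting that the recursive definition of [volume] offers, so
    the proof inducts until the j-th coordinate comes first. *)
Lemma volume_section_le n (j : 'I_n) (A : set (n.-tuple (plane R)))
    (E : 'I_n -> set (plane R)) (b c : R) :
    0 <= b -> 0 <= c ->
    measurable A -> (forall k, measurable (E k)) ->
    (forall k, plane_volume R (E k) <= b%:E)%E ->
    (forall x k, A x -> k != j -> E k (tnth x k)) ->
    (forall x, plane_volume R [set w | A (tuple_set x j w)] <= c%:E)%E ->
  (volume R n A <= (b ^+ n.-1 * c)%:E)%E.
Proof.
move=> b0 c0; elim: n j A E => [[]//|n IH] j A E mA mE Eb AE Ac.
rewrite volumeS.
have mA' : measurable (@tcons R n @^-1` A).
  by rewrite -[X in measurable X]setTI; exact: measurable_tcons.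
case: (unliftP ord0 j) => [i ji|j0].
- case: n IH j A E mA mE Eb AE Ac mA' i ji => [IH j A E _ _ _ _ _ _ []//|n].
  move=> IH j A E mA mE Eb AE Ac mA' i ji.
  apply: (@le_trans _ _ ((b ^+ n * c)%:E * plane_volume R (E ord0))%E).
    apply: sfprod_le_xsection => //.
    + by move=> [w t] /= Awt; apply: (AE _ ord0 Awt); rewrite ji neq_lift.
    + by rewrite lee_fin mulr_ge0// exprn_ge0.
    move=> w; apply: (IH i _ (E \o lift ord0)) => //=.
    + exact: measurable_xsection.
    + by move=> k; exact: Eb.
    + move=> x k; rewrite /xsection/= inE /= => Awx ki.
      have := AE _ (lift ord0 k) Awx; rewrite tnth_tconsS; apply.
      by rewrite ji (inj_eq lift_inj).
    + move=> x; have := Ac (tcons (w, x)); apply: le_trans.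
      rewrite le_eqVlt; apply/orP; left; apply/eqP; congr (plane_volume R _).
      apply/seteqP; split => v; rewrite /xsection/= inE/= ji tuple_set_tconsS//.
  rewrite [leRHS](_ : _ = (b ^+ n * c)%:E * b%:E)%E; last first.
    by rewrite -EFinM mulrAC -exprSr.
  by apply: lee_pmul => //; rewrite lee_fin mulr_ge0// exprn_ge0.
- apply: (@le_trans _ _ (c%:E * volume R n (tbox (E \o lift ord0)))%E).
    apply: sfprod_le_ysection => //.
    + by apply: measurable_tbox => k; exact: mE.
    + move=> [w t] /= Awt k /=; have := AE _ (lift ord0 k) Awt.
      by rewrite tnth_tconsS; apply; rewrite j0 eq_sym neq_lift.
    move=> t; have := Ac (tcons (0, t)); apply: le_trans.
    rewrite le_eqVlt; apply/orP; left; apply/eqP; congr (plane_volume R _).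
    by apply/seteqP; split => v; rewrite /ysection/= inE/= j0 tuple_set_tcons0.
  rewrite /= [in leRHS]mulrC [leRHS]EFinM; apply: lee_pmul => //.
  by apply: volume_tbox => // k; [exact: mE|exact: Eb].
Qed.

End volume_sections.

(** * Pieces of annuli in the plane *)

Section plane_area.
Variable R : realType.
Local Notation leb := (@lebesgue_measure R).

Lemma lebesgue_itvcc (a b : R) : a <= b -> leb `[a, b] = (b - a)%:E.
Proof.
move=> ab; rewrite lebesgue_measure_itv/= lte_fin; case: ifPn => [//|].
by rewrite -leNgt => ba; rewrite (@le_anti _ _ a b) ?ab// subrr.
Qed.

(** Two points x < x' of the slab with the same sign satisfy
    2 m (x' - x) <= x'^2 - x^2 <= k: each sign contributes length k / (2 m). *)
Lemma lebesgue_sqr_slab (L : set (measurableTypeR R)) (m B k : R) :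
    measurable L -> 0 < m -> 0 < k ->
    (forall x, L x -> [/\ m <= `|x|, B < x ^+ 2 & x ^+ 2 < B + k]) ->
  (leb L <= (k / m)%:E)%E.
Proof.
move=> mL m0 k0 LP.
pose x1 := Num.max m (Num.sqrt B); pose w := k / (m *+ 2).
have w0 : 0 < w by rewrite divr_gt0 ?pmulrn_lgt0.
have key (x : R) : 0 <= x -> m <= x -> B < x ^+ 2 -> x ^+ 2 < B + k ->
    x1 <= x /\ x <= x1 + w.
  move=> x0 mx Bx xB; have x1x : x1 <= x.
    rewrite /x1 ge_max mx/= -[leRHS]ger0_norm// -sqrtr_sqr.
    by apply: ler_wsqrtr; exact: ltW.
  split => //.
  have x1B : B <= x1 ^+ 2.
    have [B0|B0] := leP 0 B; last by rewrite (le_trans (ltW B0))// sqr_ge0.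
    rewrite -[leLHS]sqr_sqrtr// ler_sqr ?nnegrE ?sqrtr_ge0//.
      by rewrite /x1 le_max lexx orbT.
    by rewrite /x1 le_max sqrtr_ge0 orbT.
  have mx1 : m <= x1 by rewrite /x1 le_max lexx.
  rewrite -lerBlDl /w ler_pdivlMr ?pmulrn_lgt0//.
  have : 0 <= (x - x1) * (x - m + (x1 - m)).
    by apply: mulr_ge0; lra.
  nra.
have LS : L `<=` `[x1, x1 + w] `|` `[- x1 - w, - x1].
  move=> x /LP[mx Bx xB]; have [x0|x0] := leP 0 x.
    left => /=; rewrite in_itv/=; rewrite ger0_norm// in mx.
    by have [-> ->] := key _ x0 mx Bx xB.
  right => /=; rewrite in_itv/=; rewrite ltr0_norm// in mx.
  have [|//|||? ?] := key (- x); rewrite ?sqrrN//; first lra.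
  by apply/andP; split; lra.
apply: (le_trans (le_measure leb _ _ LS)); rewrite ?inE//.
  by apply: measurableU; exact: measurable_itv.
apply: (le_trans (measureU2 _ _ _)); [exact: measurable_itv..|].
rewrite /= !lebesgue_itvcc; [|lra..].
rewrite -EFinD lee_fin /w le_eqVlt; apply/orP; left; apply/eqP.
by field; rewrite gt_eqF.
Qed.

(** Since |u| >= m, one of the two coordinates has absolute value at least m / 2.
    Where it is the first one, the horizontal lines meet T in slabs of
    [lebesgue_sqr_slab], and only a set of lines of measure 2 d meets T. *)
Lemma area_annulus_piece (T : set (plane R)) (m A k d x0 y0 : R) :
    measurable T -> 0 < m -> 0 < k -> 0 <= d ->
    (forall u, T u -> [/\ m ^+ 2 <= u.1 ^+ 2 + u.2 ^+ 2,
       A < u.1 ^+ 2 + u.2 ^+ 2 & u.1 ^+ 2 + u.2 ^+ 2 < A + k]) ->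
    (forall u, T u -> `|u.1 - x0| <= d /\ `|u.2 - y0| <= d) ->
  (plane_volume R T <= (8 * d * k / m)%:E)%E.
Proof.
move=> mT m0 k0 d0 TA Td.
have m20 : 0 < m / 2 by rewrite divr_gt0.
pose X := [set u : plane R | m / 2 <= `|u.1|].
pose Y := [set u : plane R | m / 2 <= `|u.2|].
have mX : measurable X.
  rewrite -[X]setTI; apply: measurable_fun_le; first exact: measurableT.
    exact: measurable_cst.
  by apply: measurableT_comp => //; exact: measurable_fst.
have mY : measurable Y.
  rewrite -[Y]setTI; apply: measurable_fun_le; first exact: measurableT.
    exact: measurable_cst.
  by apply: measurableT_comp => //; exact: measurable_snd.
have TXY : T `<=` (T `&` X) `|` (T `&` Y).
  move=> u Tu; have [H _ _] := TA _ Tu.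
  have [Xu|Xu] := leP (m / 2) `|u.1|; first by left.
  have [Yu|Yu] := leP (m / 2) `|u.2|; first by right.
  exfalso; move: H; rewrite -(real_normK (num_real u.1)) -(real_normK (num_real u.2)).
  have := normr_ge0 u.1; have := normr_ge0 u.2; nra.
have mTX : measurable (T `&` X) by exact: measurableI.
have mTY : measurable (T `&` Y) by exact: measurableI.
have mE (c : R) : @measurable _ (measurableTypeR R) `[c - d, c + d].
  exact: measurable_itv.
have c0 : 0 <= k / (m / 2) by rewrite divr_ge0// ltW.
apply: (le_trans (le_measure _ _ _ TXY)); rewrite ?inE//.
  exact: measurableU.
apply: (le_trans (measureU2 _ _ _)) => //.
have -> : (8 * d * k / m) = k / (m / 2) * (2 * d) + k / (m / 2) * (2 * d).
  by field; rewrite gt_eqF.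
rewrite EFinD EFinM; apply: leeD.
  rewrite (_ : (2 * d) = y0 + d - (y0 - d)); last by ring.
  rewrite -lebesgue_itvcc; last lra.
  apply: sfprod_le_ysection => //.
  - move=> u [/Td[_]] /=; rewrite in_itv/= ler_norml => /andP[? ?] _.
    by apply/andP; split; lra.
  - move=> y; apply: (@lebesgue_sqr_slab _ _ (A - y ^+ 2)) => //.
      exact: measurable_ysection.
    move=> x; rewrite /ysection/= inE => -[/TA/=[_ ? ?] Xx]; split => //; lra.
rewrite (_ : (2 * d) = x0 + d - (x0 - d)); last by ring.
rewrite -lebesgue_itvcc; last lra.
apply: sfprod_le_xsection => //.
- move=> u [/Td[+ _]] /=; rewrite in_itv/= ler_norml => /andP[? ?] _.
  by apply/andP; split; lra.
- move=> x; apply: (@lebesgue_sqr_slab _ _ (A - x ^+ 2)) => //.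
    exact: measurable_xsection.
  move=> y; rewrite /xsection/= inE => -[/TA/=[_ ? ?] Xx]; split => //; lra.
Qed.

Lemma area_square (x0 y0 d : R) : 0 <= d ->
  plane_volume R (`[x0 - d, x0 + d] `*` `[y0 - d, y0 + d]) = ((2 * d) ^+ 2)%:E.
Proof.
move=> d0; rewrite /= /sfprod product_measure1E; [|exact: measurable_itv..].
rewrite /= !lebesgue_itvcc; [|lra..].
by rewrite -EFinM; congr (_%:E); ring.
Qed.

End plane_area.

(** * Volume of truncated nonisotropic balls *)

Section nonisotropic_balls.
Variable R : realType.

Lemma norm_le_of_sqr (y d : R) : 0 <= d -> y ^+ 2 <= d ^+ 2 -> `|y| <= d.
Proof.
by move=> d0 yd; rewrite -[leRHS]ger0_norm// -!sqrtr_sqr; exact: ler_wsqrtr.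
Qed.

Section coordinates.
Variable n : nat.
Implicit Types x a : n.-tuple (plane R).

(** The quantities |z|^2, Re <z,a>, Im <z,a> and |1 - <z,a>|^2 in real
    coordinates. *)
Definition tsqn x : R := \sum_j ((tnth x j).1 ^+ 2 + (tnth x j).2 ^+ 2).

Definition tRe x a : R :=
  \sum_j ((tnth x j).1 * (tnth a j).1 + (tnth x j).2 * (tnth a j).2).

Definition tIm x a : R :=
  \sum_j ((tnth x j).2 * (tnth a j).1 - (tnth x j).1 * (tnth a j).2).

Definition tdist2 x a : R := (1 - tRe x a) ^+ 2 + tIm x a ^+ 2.

Definition nonisoball a (h k : R) : set (n.-tuple (plane R)) :=
  [set x | [/\ tsqn x < 1, tdist2 x a < h ^+ 2 & 1 - tsqn x < k]].

Lemma measurable_coord1 (j : 'I_n) :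
  measurable_fun setT (fun x : n.-tuple (plane R) => (tnth x j).1 : R).
Proof. apply: measurableT_comp; [exact: measurable_fst | exact: measurable_tnth]. Qed.

Lemma measurable_coord2 (j : 'I_n) :
  measurable_fun setT (fun x : n.-tuple (plane R) => (tnth x j).2 : R).
Proof. apply: measurableT_comp; [exact: measurable_snd | exact: measurable_tnth]. Qed.

Lemma measurable_tsqn : measurable_fun setT tsqn.
Proof.
apply: measurable_sum => j; apply: measurable_funD; apply: measurable_funX.
  exact: measurable_coord1.
exact: measurable_coord2.
Qed.

Lemma measurable_tRe a : measurable_fun setT (tRe ^~ a).
Proof.
apply: measurable_sum => j; apply: measurable_funD; apply: measurable_funM => //.
  exact: measurable_coord1.
exact: measurable_coord2.
Qed.

Lemma measurable_tIm a : measurable_fun setT (tIm ^~ a).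
Proof.
apply: measurable_sum => j; apply: measurable_funB; apply: measurable_funM => //.
  exact: measurable_coord2.
exact: measurable_coord1.
Qed.

Lemma measurable_ltset (f g : n.-tuple (plane R) -> R) :
  measurable_fun setT f -> measurable_fun setT g -> measurable [set x | f x < g x].
Proof.
move=> mf mg; have := measurable_fun_ltr mf mg measurableT.
move=> /(_ [set true]); rewrite setTI; exact.
Qed.

Lemma measurable_nonisoball a h k : measurable (nonisoball a h k).
Proof.
rewrite (_ : nonisoball a h k = [set x | tsqn x < 1] `&`
   ([set x | tdist2 x a < h ^+ 2] `&` [set x | 1 - tsqn x < k])); last first.
  by apply/seteqP; split => x; [case|case=> ? []].
apply: measurableI; first by apply: measurable_ltset => //; exact: measurable_tsqn.
apply: measurableI; apply: measurable_ltset => //.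
  apply: measurable_funD; apply: measurable_funX; last exact: measurable_tIm.
  by apply: measurable_funB => //; exact: measurable_tRe.
by apply: measurable_funB => //; exact: measurable_tsqn.
Qed.

Lemma measurable_nonisoball_cap a j m h k :
  measurable (nonisoball a h k `&`
    [set x | m ^+ 2 <= (tnth x j).1 ^+ 2 + (tnth x j).2 ^+ 2]).
Proof.
apply: measurableI; first exact: measurable_nonisoball.
rewrite (_ : [set _ | _] = ~` [set x : n.-tuple (plane R) |
    (tnth x j).1 ^+ 2 + (tnth x j).2 ^+ 2 < m ^+ 2]); last first.
  by apply/seteqP; split => x /=; rewrite leNgt => /negP.
apply: measurableC; apply: measurable_ltset => //.
apply: measurable_funD; apply: measurable_funX.
  exact: measurable_coord1.
exact: measurable_coord2.
Qed.

Lemma tsqn_ge0 x : 0 <= tsqn x.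
Proof. by apply: sumr_ge0 => j _; rewrite addr_ge0 ?sqr_ge0. Qed.

Lemma tsqn_ge_coord x j : (tnth x j).1 ^+ 2 + (tnth x j).2 ^+ 2 <= tsqn x.
Proof.
rewrite /tsqn (bigD1 j)//= lerDl; apply: sumr_ge0 => i _.
by rewrite addr_ge0 ?sqr_ge0.
Qed.

Lemma tsqnB x a :
  \sum_j (((tnth x j).1 - (tnth a j).1) ^+ 2 + ((tnth x j).2 - (tnth a j).2) ^+ 2)
  = tsqn x + tsqn a - 2 * tRe x a.
Proof.
rewrite /tsqn /tRe mulr_sumr -big_split -sumrB; apply: eq_bigr => j _ /=.
ring.
Qed.

Lemma coord_dist_le x a j :
  ((tnth x j).1 - (tnth a j).1) ^+ 2 + ((tnth x j).2 - (tnth a j).2) ^+ 2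
  <= tsqn x + tsqn a - 2 * tRe x a.
Proof.
rewrite -tsqnB (bigD1 j)//= lerDl; apply: sumr_ge0 => i _.
by rewrite addr_ge0 ?sqr_ge0.
Qed.

Lemma tuple_set_sum (F : 'I_n -> plane R -> R) x j w :
  \sum_k F k (tnth (tuple_set x j w) k) = F j w + \sum_(k | k != j) F k (tnth x k).
Proof.
rewrite (bigD1 j)//= tnth_mktuple eqxx; congr (_ + _).
by apply: eq_bigr => k /negPf kj; rewrite tnth_mktuple kj.
Qed.

Lemma tnth_tset x j w : tnth (tuple_set x j w) j = w.
Proof. by rewrite tnth_mktuple eqxx. Qed.

Lemma measurable_tset x j : measurable_fun setT (tuple_set x j).
Proof.
apply/measurable_fun_tnthP => i.
rewrite (_ : _ \o _ = fun w => if i == j then w else tnth x i).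
  by case: (i == j); [exact: measurable_id | exact: measurable_cst].
by apply/funext => w /=; rewrite tnth_mktuple.
Qed.

(** This is |(v - w) conj(a_j)|^2: <z,a> is affine in z_j with slope conj(a_j). *)
Lemma tuple_set_increment x a j v w :
  (tRe (tuple_set x j v) a - tRe (tuple_set x j w) a) ^+ 2
  + (tIm (tuple_set x j v) a - tIm (tuple_set x j w) a) ^+ 2
  = ((v.1 - w.1) ^+ 2 + (v.2 - w.2) ^+ 2)
    * ((tnth a j).1 ^+ 2 + (tnth a j).2 ^+ 2).
Proof.
rewrite /tRe /tIm.
rewrite !(tuple_set_sum (fun k u => u.1 * (tnth a k).1 + u.2 * (tnth a k).2)).
rewrite !(tuple_set_sum (fun k u => u.2 * (tnth a k).1 - u.1 * (tnth a k).2)).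
ring.
Qed.

Lemma tdist2_lt_Re x a h : 0 < h -> tdist2 x a < h ^+ 2 -> 1 - tRe x a < h.
Proof.
move=> h0 H; have : (1 - tRe x a) ^+ 2 < h ^+ 2.
  by apply: le_lt_trans H; rewrite /tdist2 lerDl sqr_ge0.
move=> H2; rewrite ltNge; apply/negP => H3.
move: H2; rewrite ltNge => /negP; apply; rewrite ler_sqr ?nnegrE//.
  exact: ltW.
by rewrite (le_trans _ H3)// ltW.
Qed.

End coordinates.

(** All coordinates but the j-th are within sqrt (2 h) of those of a. Two points
    of the ball that differ only in the j-th coordinate have
    |z_j - w_j| |a_j| < 2 h. If 8 h <= m^2, then |a_j| >= m / 2, so
    |z_j - w_j| <= 4 h / m; otherwise |z_j - w_j| <= 2 <= 16 h / m^2. The value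
    16 h / m^2 covers both cases as m <= 1. *)
Lemma volume_nonisoball_cap n (a : n.-tuple (plane R)) (j : 'I_n) (m h k : R) :
    tsqn a < 1 -> 0 < m -> m <= 1 -> 0 < h -> 0 < k ->
  (volume R n (nonisoball a h k `&`
     [set x | m ^+ 2 <= (tnth x j).1 ^+ 2 + (tnth x j).2 ^+ 2]%R)
   <= ((8 * h) ^+ n.-1 * (8 * (16 * h / m ^+ 2) * k / m))%:E)%E.
Proof.
move=> a1 m0 m1 h0 k0.
set S := _ `&` _.
pose d1 := Num.sqrt (2 * h).
have d12 : d1 ^+ 2 = 2 * h by rewrite sqr_sqrtr// mulr_ge0// ltW.
have d10 : 0 <= d1 by exact: sqrtr_ge0.
have mS : measurable S := measurable_nonisoball_cap a j m h k.
have close x : S x -> tsqn x + tsqn a - 2 * tRe x a < 2 * h.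
  move=> [[x1 /(tdist2_lt_Re h0) xa _] _]; lra.
pose E i : set (plane R) := `[(tnth a i).1 - d1, (tnth a i).1 + d1] `*`
                            `[(tnth a i).2 - d1, (tnth a i).2 + d1].
apply: (@volume_section_le R n j S E) => //.
- by rewrite mulr_ge0// ltW.
- by rewrite !mulr_ge0 ?invr_ge0 ?mulr_ge0 ?exprn_ge0 ?ltW.
- by move=> i; apply: measurableX; exact: measurable_itv.
- by move=> i; rewrite area_square// lee_fin exprMn d12; lra.
- move=> x i /close + _; have := coord_dist_le x a i; rewrite -d12 => H1 H2.
  have {H1 H2} /ltW H := le_lt_trans H1 H2.
  rewrite /E/=; split; rewrite /= in_itv/= -ler_distl; apply: norm_le_of_sqr => //;
    apply: le_trans H; by rewrite ?lerDl ?lerDr sqr_ge0.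
move=> x.
have [[w0 Sw0]|noS] := pselect (exists w, S (tuple_set x j w)); last first.
  rewrite (_ : [set w | _] = set0) ?measure0 ?lee_fin.
    by rewrite !mulr_ge0 ?invr_ge0 ?mulr_ge0 ?exprn_ge0 ?ltW.
  by apply/seteqP; split => // w Sw; apply: noS; exists w.
have d0 : 0 <= 16 * h / m ^+ 2.
  by rewrite !mulr_ge0 ?invr_ge0 ?exprn_ge0 ?ltW.
have tsqnE w : tsqn (tuple_set x j w) = w.1 ^+ 2 + w.2 ^+ 2
    + \sum_(i | i != j) ((tnth x i).1 ^+ 2 + (tnth x i).2 ^+ 2).
  exact: (tuple_set_sum (fun _ u => u.1 ^+ 2 + u.2 ^+ 2)).
set r := \sum_(i | i != j) _ in tsqnE.
apply: (@area_annulus_piece R _ m (1 - k - r) k _ w0.1 w0.2) => //.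
- by rewrite -[X in measurable X]setTI; exact: measurable_tset.
- move=> u [[u1 _ uk] /=]; rewrite tnth_tset => um.
  by move: u1 uk; rewrite tsqnE => *; split=> //; lra.
move=> u Su.
have : (u.1 - w0.1) ^+ 2 + (u.2 - w0.2) ^+ 2 <= (16 * h / m ^+ 2) ^+ 2.
  have m20 : 0 < m ^+ 2 by rewrite exprn_gt0.
  rewrite expr_div_n ler_pdivlMr ?exprn_gt0//.
  set D := (X in X * _).
  have D0 : 0 <= D by rewrite addr_ge0 ?sqr_ge0.
  have m21 : m ^+ 2 <= 1 by rewrite expr_le1// ltW.
  have [hs|hl] := leP (8 * h) (m ^+ 2).
    have aj : m ^+ 2 <= 4 * ((tnth a j).1 ^+ 2 + (tnth a j).2 ^+ 2).
      have := coord_dist_le (tuple_set x j u) a j; rewrite tnth_tset.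
      have := close _ Su; case: Su => _ /=; rewrite tnth_tset.
      have := sqr_ge0 (u.1 - 2 * (tnth a j).1).
      have := sqr_ge0 (u.2 - 2 * (tnth a j).2).
      nra.
    have := tuple_set_increment x a j u w0.
    have pu : tdist2 (tuple_set x j u) a < h ^+ 2 by case: Su => [[]].
    have pw : tdist2 (tuple_set x j w0) a < h ^+ 2 by case: Sw0 => [[]].
    move: pu pw; rewrite /tdist2.
    set p := tRe _ _; set p' := tIm _ _; set q := tRe _ _; set q' := tIm _ _.
    set Aj := (X in _ = _ * X) => pu pw inc.
    have DA : D * Aj <= 4 * h ^+ 2.
      rewrite /D -inc.
      have := sqr_ge0 ((1 - p) + (1 - q)); have := sqr_ge0 (p' + q').
      nra.
    rewrite -/Aj in aj; have DM : D * m ^+ 2 <= 16 * h ^+ 2.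
      by apply: le_trans (ler_wpM2l D0 aj) _; rewrite mulrCA; lra.
    rewrite (expr2 (m ^+ 2)) mulrA; apply: (@le_trans _ _ (16 * h ^+ 2)).
      apply: le_trans DM; apply: ler_piMr => //; exact: mulr_ge0 (ltW m20).
    by have := sqr_ge0 h; rewrite exprMn; lra.
  have u1 : u.1 ^+ 2 + u.2 ^+ 2 <= 1.
    case: Su => [[+ _ _] _] => /ltW; apply: le_trans.
    by have := tsqn_ge_coord (tuple_set x j u) j; rewrite tnth_tset.
  have w01 : w0.1 ^+ 2 + w0.2 ^+ 2 <= 1.
    case: Sw0 => [[+ _ _] _] => /ltW; apply: le_trans.
    by have := tsqn_ge_coord (tuple_set x j w0) j; rewrite tnth_tset.
  have D4 : D <= 4.
    rewrite /D; have := sqr_ge0 (u.1 + w0.1); have := sqr_ge0 (u.2 + w0.2).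
    nra.
  have M8 : (m ^+ 2) ^+ 2 <= (8 * h) ^+ 2.
    by rewrite ler_sqr ?nnegrE ltW// mulr_gt0.
  apply: (@le_trans _ _ (4 * (8 * h) ^+ 2)).
    by apply: ler_pM => //; exact: sqr_ge0.
  by rewrite !exprMn; lra.
move=> H; split; apply: norm_le_of_sqr => //; apply: le_trans H.
  by rewrite lerDl sqr_ge0.
by rewrite lerDr sqr_ge0.
Qed.

(** If k <= 1/2 then |z|^2 > 1/2, and one of the n + 1 coordinates satisfies
    |z_j|^2 >= m^2 with m = 1 / (2 (n + 1)), so the caps cover the ball. *)
Lemma volume_nonisoball n : exists2 C : R, 0 < C &
  forall (a : n.+1.-tuple (plane R)) (h k : R),
    tsqn a < 1 -> 0 < h -> 0 < k -> k <= 2 * h ->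
  (volume R n.+1 (nonisoball a h k) <= (C * (h ^+ n.+1 * k))%:E)%E.
Proof.
pose m : R := (2 * n.+1%:R)^-1.
have n1 : (1 : R) <= n.+1%:R by rewrite ler1n.
have m0 : 0 < m by rewrite invr_gt0; lra.
have m1 : m <= 1 by rewrite invf_le1; lra.
have mm : m * (2 * n.+1%:R) = 1 by rewrite mulVf// gt_eqF//; lra.
pose C1 : R := n.+1%:R * (8 ^+ n * 128 / m ^+ 3).
pose C2 : R := 2 * 16 ^+ n.+1.
have C10 : 0 < C1 by rewrite !mulr_gt0 ?invr_gt0 ?exprn_gt0.
have C20 : 0 < C2 by rewrite !mulr_gt0 ?exprn_gt0.
exists (C1 + C2); first exact: addr_gt0.
move=> a h k a1 h0 k0 kh.
have hk0 : 0 <= h ^+ n.+1 * k by rewrite mulr_ge0 ?exprn_ge0// ltW.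
have [k2|k2] := leP k (1/2); last first.
  apply: (@le_trans _ _ (4 ^+ n.+1)%:E); last first.
    rewrite lee_fin; apply: (@le_trans _ _ (C2 * (h ^+ n.+1 * k))).
      have h4 : 1 / 4 <= h by lra.
      have : (1 / 4) ^+ n.+1 <= h ^+ n.+1 :> R by apply: lerXn2r; rewrite ?nnegrE; lra.
      have -> : C2 = 2 * 4 ^+ n.+1 * 4 ^+ n.+1.
        by rewrite /C2 -mulrA -exprMn; congr (_ * _ ^+ _); ring.
      have e4 : (4 : R) ^+ n.+1 * (1/4) ^+ n.+1 = 1.
        by rewrite -exprMn (_ : 4 * (1/4) = 1) ?expr1n//; field.
      have : 0 < (4 : R) ^+ n.+1 by rewrite exprn_gt0.
      move: e4; set A := 4 ^+ _; set B := (1 / 4) ^+ _; set H := h ^+ _ => e4 A0 BH.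
      have AH : 1 <= A * H by rewrite -e4; apply: ler_wpM2l => //; exact: ltW.
      rewrite (_ : _ * (H * k) = A * ((2 * k) * (A * H))); last by ring.
      apply: ler_peMr; first exact: ltW.
      by apply: mulr_ege1 => //; lra.
    by apply: ler_wpM2r => //; lra.
  pose E (i : 'I_n.+1) : set (plane R) := `[0 - 1, 0 + 1] `*` `[0 - 1, 0 + 1].
  have mE i : measurable (E i) by apply: measurableX; exact: measurable_itv.
  apply: (@le_trans _ _ (volume R n.+1 (tbox E))).
    apply: le_measure; rewrite ?inE.
    - exact: measurable_nonisoball.
    - exact: measurable_tbox.
    move=> x [x1 _ _] i.
    have /le_lt_trans/(_ x1)/ltW H := tsqn_ge_coord x i.
    have e1 : 1 = 1 ^+ 2 :> R by rewrite expr1n.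
    rewrite /E/=; split; rewrite /= in_itv/= -ler_distl subr0;
      apply: norm_le_of_sqr => //; rewrite -e1; apply: le_trans H;
      by rewrite ?lerDl ?lerDr sqr_ge0.
  apply: volume_tbox => // i.
  by rewrite area_square// lee_fin; lra.
pose P (j : 'I_n.+1) := nonisoball a h k `&`
  [set x | m ^+ 2 <= (tnth x j).1 ^+ 2 + (tnth x j).2 ^+ 2].
have mP j : measurable (P j) by exact: measurable_nonisoball_cap.
have sub : nonisoball a h k `<=` \big[setU/set0]_(i < n.+1) P (inord i).
  move=> x Sx; rewrite -(bigcup_mkord _ (fun i => P (inord i))); have [_ _ xk] := Sx.
  have [[j jm]|noj] := pselect (exists j, m ^+ 2 <= (tnth x j).1 ^+ 2 + (tnth x j).2 ^+ 2).
    by exists j => /=; [exact: ltn_ord | rewrite inord_val].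
  exfalso.
  have : tsqn x <= \sum_(j < n.+1) m ^+ 2.
    apply: ler_sum => j _; rewrite leNgt; apply/negP => H; apply: noj.
    by exists j; exact: ltW.
  rewrite sumr_const card_ord -mulr_natl; nra.
have := @content_subadditive _ _ _ (volume R n.+1) _ (fun i => P (inord i)) n.+1
  (fun i _ => mP _) (@measurable_nonisoball _ a h k) sub.
move=> /le_trans; apply.
apply: (@le_trans _ _ (\sum_(i < n.+1) (8 ^+ n * 128 / m ^+ 3 * (h ^+ n.+1 * k))%:E)%E).
  apply: lee_sum => i _; apply: le_trans (volume_nonisoball_cap _ a1 m0 m1 h0 k0) _.
  rewrite lee_fin le_eqVlt; apply/orP; left; apply/eqP => /=.
  rewrite exprMn [h ^+ n.+1]exprS; field.
  by rewrite gt_eqF.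
rewrite sumEFin lee_fin sumr_const card_ord -[leLHS]mulr_natl.
rewrite [leLHS](_ : _ = C1 * (h ^+ n.+1 * k)); last exact: mulrA.
by apply: ler_wpM2r => //; lra.
Qed.

End nonisotropic_balls.

(** * The automorphisms Phi_a *)

Section hermitian.
Local Open Scope complex_scope.
Variables (R : realType) (n : nat).
Implicit Types (z w v a : 'rV[R[i]]_n) (c d : R[i]).

Lemma sqr_normcE c : (Normc.normc c ^+ 2)%:C = c * c^*%C.
Proof.
case: c => x y; rewrite /= sqr_sqrtr ?addr_ge0 ?sqr_ge0//; simpc.
by apply/eqP; rewrite eq_complex/=; apply/andP; split; apply/eqP; ring.
Qed.

Lemma sqr_normc_ReIm (x y : R) : Normc.normc (x +i* y) ^+ 2 = x ^+ 2 + y ^+ 2.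
Proof. by rewrite sqr_sqrtr ?addr_ge0 ?sqr_ge0. Qed.

Lemma normc_ge0 c : 0 <= Normc.normc c.
Proof. by case: c => x y; exact: sqrtr_ge0. Qed.

Lemma sqr_enorm z : enorm z ^+ 2 = \sum_j Normc.normc (z 0 j) ^+ 2.
Proof. by rewrite sqr_sqrtr//; apply: sumr_ge0 => j _; exact: sqr_ge0. Qed.

Lemma enorm_ge0 z : 0 <= enorm z.
Proof. exact: sqrtr_ge0. Qed.

Lemma cdotzz z : cdot z z = (enorm z ^+ 2)%:C.
Proof.
by rewrite sqr_enorm rmorph_sum; apply: eq_bigr => j _; exact/esym/sqr_normcE.
Qed.

Lemma cdotDl z w v : cdot (z + w) v = cdot z v + cdot w v.
Proof. by rewrite -big_split; apply: eq_bigr => j _; rewrite mxE mulrDl. Qed.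

Lemma cdotZl c z v : cdot (c *: z) v = c * cdot z v.
Proof. by rewrite mulr_sumr; apply: eq_bigr => j _; rewrite mxE mulrA. Qed.

Lemma cdotC z w : cdot w z = (cdot z w)^*%C.
Proof.
rewrite rmorph_sum; apply: eq_bigr => j _.
by rewrite rmorphM/= conjcK mulrC.
Qed.

Lemma cdotDr v z w : cdot v (z + w) = cdot v z + cdot v w.
Proof. by rewrite -big_split; apply: eq_bigr => j _; rewrite mxE rmorphD mulrDr. Qed.

Lemma cdotZr c v z : cdot v (c *: z) = c^*%C * cdot v z.
Proof. by rewrite mulr_sumr; apply: eq_bigr => j _; rewrite mxE rmorphM mulrCA. Qed.

Lemma cdot_comb a z c c' d d' : c^*%C = c' -> d^*%C = d' ->
  cdot (c *: a + d *: z) (c *: a + d *: z) =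
  c * c' * cdot a a + c * d' * cdot a z + d * c' * cdot z a + d * d' * cdot z z.
Proof.
move=> cc dd; rewrite cdotDl !cdotDr !cdotZl !cdotZr cc dd.
by rewrite !mulrA !addrA.
Qed.

Lemma enormZ c z : enorm (c *: z) = Normc.normc c * enorm z.
Proof.
rewrite /enorm -[Normc.normc c]ger0_norm ?normc_ge0// -sqrtr_sqr -sqrtrM ?sqr_ge0//.
congr Num.sqrt; rewrite mulr_sumr; apply: eq_bigr => j _.
by rewrite mxE Normc.normcM exprMn.
Qed.

Lemma Phi_comb a z : Phi a z = (1 - cdot z a)^-1 *:
  ((1 + ((Num.sqrt (1 - enorm a ^+ 2))%:C - 1) * (cdot z a / cdot a a)) *: a
   + (- (Num.sqrt (1 - enorm a ^+ 2))%:C) *: z).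
Proof.
rewrite /Phi; congr (_ *: _); rewrite /projQ /projP.
by apply/rowP => j; rewrite !mxE; ring.
Qed.

(** Expand |alpha a + beta z|^2 for the coefficients of [Phi_comb], using
    s_a^2 = 1 - |a|^2. The case a = 0 is apart, since the projection onto the
    span of a is then defined through a division by 0. *)
Lemma one_sub_sqr_Phi a z : enorm a < 1 -> cdot z a != 1 ->
  1 - enorm (Phi a z) ^+ 2 =
  (1 - enorm a ^+ 2) * (1 - enorm z ^+ 2) / Normc.normc (1 - cdot z a) ^+ 2.
Proof.
move=> a1 za1.
have D0 : 1 - cdot z a != 0 by rewrite subr_eq0 eq_sym.
have N0 : Normc.normc (1 - cdot z a) ^+ 2 != 0.
  rewrite sqrf_eq0; apply: contra D0 => /eqP/Normc.eq0_normc ->.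
  by [].
apply: (canRL (mulfK N0)); apply: (@complexI R).
set s := Num.sqrt (1 - enorm a ^+ 2).
have s2 : (s%:C) ^+ 2 = 1 - cdot a a.
  have : 0 <= 1 - enorm a ^+ 2.
    by rewrite subr_ge0 expr_le1 ?enorm_ge0// ltW.
  by move=> H; rewrite -rmorphXn sqr_sqrtr//= rmorphB rmorph1 cdotzz.
have CM x y : (x * y)%:C = x%:C * y%:C :> R[i] by exact: rmorphM.
have CB x : (1 - x)%:C = 1 - x%:C :> R[i] by rewrite rmorphB rmorph1.
rewrite [LHS]CM [RHS]CM !CB sqr_normcE -!cdotzz.
move: s2 D0; rewrite Phi_comb -/s; set t := cdot z a; set A := cdot a a.
set Z := cdot z z; set S := s%:C => S2 D0.
have tc : cdot a z = t^*%C by rewrite cdotC.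
have Ac : A^*%C = A by rewrite -cdotC.
have Sc : S^*%C = S by exact: conjc_real.
have E1 : (1 - t)^*%C = 1 - t^*%C by rewrite rmorphB rmorph1.
have D1 : 1 - t^*%C != 0.
  by rewrite -E1 conjc_eq0.
have J1 : ((1 - t)^-1)^*%C = (1 - t^*%C)^-1 by rewrite conjc_inv E1.
rewrite cdotZl cdotZr J1.
set v := (_ *: a + _).
suff Ev : cdot v v = A - (t + t^*%C) + t * t^*%C + (1 - A) * Z.
  by rewrite Ev; field; rewrite D0 D1.
have Jc : (1 + (S - 1) * (t / A))^*%C = 1 + (S - 1) * (t^*%C / A).
  rewrite rmorphD rmorph1 rmorphM rmorphB rmorph1 rmorphM fmorphV.
  by rewrite [X in _ / X]Ac [X in X - 1]Sc.
have JN : (- S)^*%C = - S by rewrite rmorphN; congr (- _); exact: Sc.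
have Ev : cdot v v = (1 + (S - 1) * (t / A)) * (1 + (S - 1) * (t^*%C / A)) * A
   - S * ((1 + (S - 1) * (t / A)) * t^*%C + (1 + (S - 1) * (t^*%C / A)) * t) + S ^+ 2 * Z.
  rewrite /v (cdot_comb a z Jc JN) -/t -/A -/Z tc.
  by move: (t^*%C) => t'; ring.
rewrite Ev; have [A0|A0] := eqVneq A 0; last first.
  have AE : A = 1 - S ^+ 2 by rewrite S2; ring.
  move: A0; rewrite AE; move: (t^*%C) => t' A0.
  by field; exact: A0.
have t0 : t = 0.
  have : enorm a ^+ 2 = 0 by apply: (@complexI R); rewrite -cdotzz.
  rewrite sqr_enorm => /psumr_eq0P a0; rewrite /t /cdot big1// => j _.
  have /eqP := a0 (fun j _ => sqr_ge0 _) j isT.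
  by rewrite sqrf_eq0 => /eqP/Normc.eq0_normc ->; rewrite conjC0 mulr0.
by rewrite t0 conjc0 A0 S2 A0; ring.
Qed.

End hermitian.

(** * From points of C^n to real coordinates *)

Section coordinates_of_points.
Local Open Scope complex_scope.
Variables (R : realType) (n : nat).
Implicit Types (x y : n.-tuple (plane R)) (a : 'rV[R[i]]_n).

Lemma cpoint_surj a : exists x, a = cpoint x.
Proof.
exists [tuple (complex.Re (a 0 j), complex.Im (a 0 j)) | j < n].
by apply/rowP => j; rewrite mxE tnth_mktuple /=; case: (a 0 j).
Qed.

Lemma sqr_enorm_cpoint x : enorm (cpoint x) ^+ 2 = tsqn x.
Proof.
by rewrite sqr_enorm; apply: eq_bigr => j _; rewrite mxE sqr_normc_ReIm.
Qed.

Lemma cdot_cpoint x y : cdot (cpoint x) (cpoint y) = tRe x y +i* tIm x y.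
Proof.
have cS I (r : seq I) (F G : I -> R) :
    \sum_(i <- r) (F i +i* G i) = (\sum_(i <- r) F i) +i* (\sum_(i <- r) G i).
  elim: r => [|i r IH]; first by rewrite !big_nil.
  by rewrite !big_cons IH.
rewrite -cS; apply: eq_bigr => j _; rewrite !mxE.
apply/eqP; rewrite eq_complex/=; apply/andP; split; apply/eqP; ring.
Qed.

Lemma sqr_normc_one_sub_cdot x y :
  Normc.normc (1 - cdot (cpoint x) (cpoint y)) ^+ 2 = tdist2 x y.
Proof.
rewrite cdot_cpoint (_ : 1 - _ = (1 - tRe x y) +i* (- tIm x y)).
  by rewrite sqr_normc_ReIm sqrrN.
by apply/eqP; rewrite eq_complex/= sub0r !eqxx.
Qed.

End coordinates_of_points.

(** * Integrals bounded by a doubly geometric covering *)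

Section covering_integral.
Local Open Scope ereal_scope.

Lemma nneseries_le_geometric (R : realType) (u : (\bar R)^nat) (K x : R) :
    (0 <= K)%R -> (0 <= x)%R -> (x < 1)%R ->
    (forall k, 0 <= u k) -> (forall k, u k <= (K * x ^+ k)%:E) ->
  \sum_(k <oo) u k <= (K / (1 - x))%:E.
Proof.
move=> K0 x0 x1 u0 uK; apply: lime_le; first exact: is_cvg_nneseries.
have x10 : (0 < 1 - x)%R by rewrite subr_gt0.
apply: nearW => m; apply: (@le_trans _ _ (K * (1 - x ^+ m) / (1 - x))%:E).
  elim: m => [|m IH]; first by rewrite big_geq// expr0 subrr mulr0 mul0r.
  rewrite big_nat_recr//=; apply: (le_trans (leeD IH (uK m))).
  rewrite -EFinD lee_fin le_eqVlt; apply/orP; left; apply/eqP.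
  by rewrite exprS; field; rewrite gt_eqF.
rewrite lee_fin; apply: ler_wpM2r; first by rewrite invr_ge0 ltW.
by apply: ler_piMr => //; rewrite gerBl exprn_ge0.
Qed.

Context d (T : measurableType d) (R : realType).
Variable mu : {measure set T -> \bar R}.

Import HBNNSimple.

(** The integral of a nonnegative function is a supremum over the simple
    functions below it, so monotonicity holds for non-measurable functions too. *)
Lemma le_integral_ge0 (D : set T) (f g : T -> \bar R) :
    (forall x, D x -> 0 <= f x) -> (forall x, D x -> f x <= g x) ->
  \int[mu]_(x in D) f x <= \int[mu]_(x in D) g x.
Proof.
move=> f0 fg; have g0 x : D x -> 0 <= g x.
  by move=> Dx; exact: le_trans (f0 _ Dx) (fg _ Dx).
rewrite !ge0_integralE//; apply: ereal_sup_le => _ [h /= hf <-].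
exists h => //= x.
apply: le_trans (hf x) _; rewrite /patch; case: ifPn => //.
by rewrite inE; exact: fg.
Qed.

(** The integrand is dominated by the sum over l, i of w l i times the indicator
    of S l i; the w l i mu (S l i) are terms of a convergent double series. *)
Lemma integral_le_double_cover (D : set T) (g : T -> R)
    (S : nat -> nat -> set T) (w : nat -> nat -> R) (K x y : R) :
    measurable D -> (forall l i, measurable (S l i)) ->
    (0 <= K)%R -> (0 <= x < 1)%R -> (0 <= y < 1)%R ->
    (forall l i, 0 <= w l i)%R ->
    (forall t, D t -> 0 <= g t)%R ->
    (forall t, D t -> exists l i, S l i t /\ (g t <= w l i)%R) ->
    (forall l i, (w l i)%:E * mu (S l i) <= (K * x ^+ l * y ^+ i)%:E) ->
  \int[mu]_(t in D) (g t)%:E <= (K / (1 - y) / (1 - x))%:E.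
Proof.
move=> mD mS K0 /andP[x0 x1] /andP[y0 y1] w0 g0 gS wS.
pose F l i t : \bar R := ((w l i)%:E * (\1_(S l i) t)%:E).
have F0 l i t : 0 <= F l i t.
  by rewrite mule_ge0 ?lee_fin.
have mF l i : measurable_fun D (F l i).
  apply: measurable_funeM; apply/measurable_EFinP.
  by apply: measurable_funTS; exact: measurable_indic.
have F0' l t : 0 <= \sum_(i <oo) F l i t by apply: nneseries_ge0 => *; exact: F0.
have intF l i : \int[mu]_(t in D) F l i t <= (K * x ^+ l * y ^+ i)%:E.
  have mI : measurable_fun D (fun t => (\1_(S l i) t)%:E : \bar R).
    by apply/measurable_EFinP; apply: measurable_funTS; exact: measurable_indic.
  rewrite ge0_integralZl//; last by rewrite lee_fin.
  rewrite integral_indic//; apply: le_trans (wS l i).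
  apply: lee_wpmul2l; rewrite ?lee_fin//.
  by apply: le_measure; rewrite ?inE//; exact: measurableI.
apply: (@le_trans _ _ (\int[mu]_(t in D) (\sum_(l <oo) \sum_(i <oo) F l i t))).
  apply: le_integral_ge0 => t Dt; first by rewrite lee_fin; exact: g0.
  have [l [i [St gw]]] := gS t Dt.
  apply: (@le_trans _ _ (F l i t)).
    by rewrite /F indicE mem_set// mule1 lee_fin.
  apply: (@le_trans _ _ (\sum_(i <oo) F l i t)).
    apply: le_trans (nneseries_lim_ge i.+1 _) => //.
    by rewrite big_nat_recr//= leeDr// sume_ge0.
  apply: le_trans (nneseries_lim_ge l.+1 _) => //.
  by rewrite big_nat_recr//= leeDr// sume_ge0.
rewrite integral_nneseries//; last first.
  by move=> l; apply: ge0_emeasurable_sum => //.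
apply: nneseries_le_geometric => //.
- by rewrite divr_ge0// subr_ge0 ltW.
- by move=> l; apply: integral_ge0.
move=> l; rewrite integral_nneseries// mulrAC.
apply: nneseries_le_geometric => //.
- by rewrite mulr_ge0// exprn_ge0.
- by move=> i; apply: integral_ge0.
Qed.

End covering_integral.

Section dyadic.
Variable R : realType.

Lemma exists_lt_pow2 (c y : R) : 0 < c -> exists l : nat, y < c * 2 ^+ l.
Proof.
move=> c0; exists (Num.bound (y / c)).
by rewrite -ltr_pdivrMl// mulrC; exact: upper_nthrootP.
Qed.

Lemma dyadic_above (c y : R) : 0 < c -> c <= 4 * y ->
  exists l : nat, y < c * 2 ^+ l /\ c * 2 ^+ l <= 4 * y.
Proof.
move=> c0 cy.
have ex := exists_lt_pow2 y c0.
case: (ex_minnP ex) => l yl lmin; exists l; split => //.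
case: l yl lmin => [|l] yl lmin; first by rewrite expr0 mulr1.
have : ~~ (y < c * 2 ^+ l) by apply/negP => /lmin; rewrite ltnn.
rewrite -leNgt exprS; lra.
Qed.

Lemma dyadic_below (c y : R) : 0 < y -> y < c ->
  exists i : nat, y < c / 2 ^+ i /\ c / 2 ^+ i <= 2 * y.
Proof.
move=> y0 yc; have ex : exists l : nat, c <= y * 2 ^+ l.
  by have [l /ltW] := exists_lt_pow2 c y0; exists l.
case: (ex_minnP ex) => -[|i]; first by rewrite expr0 mulr1 leNgt yc.
move=> ci imin; exists i.
have p0 : 0 < (2 : R) ^+ i by rewrite exprn_gt0.
rewrite ltr_pdivlMr// ler_pdivrMr//; split; last by move: ci; rewrite exprS; lra.
by rewrite ltNge; apply/negP => /imin; rewrite ltnn.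
Qed.

End dyadic.

(** * Uniform bound of the kernel integral *)

Section kernel_bound.
Variable R : realType.

Lemma half_powRX (g : R) (l : nat) : ((2^-1 : R) ^+ l) `^ g = (2^-1 `^ g) ^+ l.
Proof. by rewrite -powR_mulrn ?invr_ge0// -powRrM mulrC powRrM powR_mulrn ?powR_ge0. Qed.

(** Choose l with D < h <= 4 D and then i with rho < k <= 2 rho. Multiplying the
    kernel by h^n k leaves, up to constants,
    k^(e + g - n) (delta / h^2)^g h^n = 2^(- g l) 2^(- (e + g - n) i) h^e,
    and h <= 12 since D <= 3. *)
Lemma kernel_dyadic (n : nat) (e g rho del D : R) :
    0 < g -> 0 <= e -> n%:R < e + g ->
    0 < rho -> 0 < del -> 0 < D -> rho <= 2 * D -> del <= 2 * D -> D <= 3 ->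
  exists l i : nat, let h := del * 2 ^+ l in let k := 2 * h / 2 ^+ i in
    [/\ D < h, rho < k &
     rho `^ e * (del * rho / D ^+ 2) `^ g / rho ^+ n.+1 <=
      2 * 2 `^ (e + g - n%:R) * 16 `^ g * 12 `^ e
        * (2^-1 `^ g) ^+ l * (2^-1 `^ (e + g - n%:R)) ^+ i / (h ^+ n * k)].
Proof.
move=> g0 e0 ng rho0 del0 D0 rhoD delD D3.
have [||l [Dh hD]] := @dyadic_above R del D; [lra..|].
have h0 : 0 < del * 2 ^+ l by rewrite mulr_gt0 ?exprn_gt0.
have [||i [rk kr]] := @dyadic_below R (2 * (del * 2 ^+ l)) rho; [lra..|].
exists l, i => /=; set h := del * 2 ^+ l; set k := 2 * h / 2 ^+ i.
rewrite -/h in Dh hD h0 rk kr; rewrite -/k in rk kr; split => //.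
have k0 : 0 < k by apply: lt_trans rk.
rewrite ler_pdivlMr ?mulr_gt0 ?exprn_gt0//.
set N := e + g - n%:R; have N0 : 0 < N by rewrite /N; lra.
have h12 : h <= 12 by lra.
have delE : del = h * 2^-1 ^+ l.
  by rewrite /h exprVn mulfK// gt_eqF// exprn_gt0.
have kE : k = 2 * h * 2^-1 ^+ i by rewrite /k exprVn.
clearbody k h.
have nz b (x : R) : 0 < x -> b ==> (x != 0).
  by move=> x0; rewrite gt_eqF ?implybT.
have A1 : rho `^ e * (del * rho / D ^+ 2) `^ g / rho ^+ n.+1 * (h ^+ n * k)
    <= 2 * (rho `^ N * (del / D ^+ 2) `^ g * h ^+ n).
  have -> : rho `^ N = rho `^ e * rho `^ g / rho ^+ n.
    rewrite /N powRB; last exact: nz.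
    by rewrite powRD; [rewrite powR_mulrn// ltW|exact: nz].
  have -> : del * rho / D ^+ 2 = rho * (del / D ^+ 2) by ring.
  rewrite powRM; [|exact: ltW|by rewrite divr_ge0 ?exprn_ge0 ?ltW].
  set a := rho `^ e; set b := rho `^ g; set c := _ `^ g.
  have abc : 0 <= a * b * c by rewrite !mulr_ge0 ?powR_ge0.
  rewrite [leLHS](_ : _ = a * b * c * h ^+ n / rho ^+ n * (k / rho)); last first.
    by rewrite exprS; field; rewrite !gt_eqF ?exprn_gt0.
  rewrite [leRHS](_ : _ = a * b * c * h ^+ n / rho ^+ n * 2); last first.
    by field; rewrite gt_eqF ?exprn_gt0.
  apply: ler_wpM2l.
    apply: mulr_ge0; last by rewrite invr_ge0 exprn_ge0 ?ltW.
    by apply: mulr_ge0 => //; rewrite exprn_ge0 ?ltW.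
  by rewrite ler_pdivrMr.
apply: le_trans A1 _.
have A2 : rho `^ N <= (2 `^ N) * h `^ N * (2^-1 `^ N) ^+ i.
  have hW := ltW h0; have p0 : 0 <= (2^-1 : R) ^+ i by rewrite exprn_ge0.
  rewrite -half_powRX -powRM// -powRM ?mulr_ge0// -kE; apply: ge0_ler_powR; rewrite ?nnegrE; exact: ltW.
have A3 : (del / D ^+ 2) `^ g <= 16 `^ g * (h `^ g)^-1 * (2^-1 `^ g) ^+ l.
  have -> : (h `^ g)^-1 = h^-1 `^ g.
    by rewrite -powRN -mulN1r powRrM powR_inv1// ltW.
  have hi0 : 0 <= h^-1 by rewrite invr_ge0 ltW.
  have p0 : 0 <= (2^-1 : R) ^+ l by rewrite exprn_ge0.
  rewrite -half_powRX -!powRM ?mulr_ge0//.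
  have [delW DW hW] := And3 (ltW del0) (ltW D0) (ltW h0).
  apply: ge0_ler_powR; rewrite ?nnegrE ?mulr_ge0 ?invr_ge0 ?exprn_ge0//.
    exact: ltW.
  rewrite delE [leLHS](_ : _ = h / D ^+ 2 * 2^-1 ^+ l); last by ring.
  apply: ler_wpM2r => //; rewrite ler_pdivrMr ?exprn_gt0// mulrAC ler_pdivlMr//.
  rewrite -expr2 (_ : 16 * D ^+ 2 = (4 * D) ^+ 2); last by ring.
  by rewrite ler_sqr ?nnegrE ?mulr_ge0// ltW.
have hE : h `^ N * (h `^ g)^-1 * h ^+ n = h `^ e.
  rewrite /N powRB; last exact: nz.
  rewrite powRD; last exact: nz.
  rewrite powR_mulrn ?ltW//; field.
  by rewrite !gt_eqF ?exprn_gt0 ?powR_gt0.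
apply: (@le_trans _ _ (2 * ((2 `^ N * h `^ N * (2^-1 `^ N) ^+ i)
    * (16 `^ g * (h `^ g)^-1 * (2^-1 `^ g) ^+ l) * h ^+ n))).
  apply: ler_wpM2l => //; apply: ler_wpM2r; first by rewrite exprn_ge0 ?ltW.
  by apply: ler_pM => //; exact: powR_ge0.
rewrite [leLHS](_ : _ = 2 * 2 `^ N * 16 `^ g * (2^-1 `^ g) ^+ l * (2^-1 `^ N) ^+ i
   * (h `^ N * (h `^ g)^-1 * h ^+ n)); last by ring.
rewrite hE [leRHS](_ : _ = 2 * 2 `^ N * 16 `^ g * (2^-1 `^ g) ^+ l * (2^-1 `^ N) ^+ i
   * 12 `^ e); last by ring.
apply: ler_wpM2l; first by rewrite !mulr_ge0 ?exprn_ge0 ?powR_ge0.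
by apply: ge0_ler_powR; rewrite ?nnegrE//; exact: ltW.
Qed.

Section distance_bounds.
Variable n : nat.
Implicit Types x a : n.-tuple (plane R).

Lemma tdist2_ge x a :
  1 - tsqn x + (1 - tsqn a) <= 2 * Num.sqrt (tdist2 x a).
Proof.
have : 1 - tRe x a <= Num.sqrt (tdist2 x a).
  apply: le_trans (ler_norm _) _; rewrite -sqrtr_sqr.
  by apply: ler_wsqrtr; rewrite /tdist2 lerDl sqr_ge0.
have : 0 <= tsqn x + tsqn a - 2 * tRe x a.
  by rewrite -tsqnB; apply: sumr_ge0 => j _; rewrite addr_ge0 ?sqr_ge0.
lra.
Qed.

(** By 2 |u v| <= u^2 + v^2 the real and imaginary parts of <z,a> are at most 1
    in absolute value; then |1 - <z,a>|^2 <= 5. *)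
Lemma tdist2_le x a : tsqn x < 1 -> tsqn a < 1 -> Num.sqrt (tdist2 x a) <= 3.
Proof.
move=> x1 a1.
have sumE : tsqn x + tsqn a = \sum_j ((tnth x j).1 ^+ 2 + (tnth x j).2 ^+ 2
    + ((tnth a j).1 ^+ 2 + (tnth a j).2 ^+ 2)) by rewrite -big_split.
have Re1 : `|tRe x a| <= 1.
  have : 2 * tRe x a <= tsqn x + tsqn a.
    rewrite sumE mulr_sumr; apply: ler_sum => j _.
    have := sqr_ge0 ((tnth x j).1 - (tnth a j).1).
    have := sqr_ge0 ((tnth x j).2 - (tnth a j).2); nra.
  have : - 2 * tRe x a <= tsqn x + tsqn a.
    rewrite sumE mulr_sumr; apply: ler_sum => j _.
    have := sqr_ge0 ((tnth x j).1 + (tnth a j).1).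
    have := sqr_ge0 ((tnth x j).2 + (tnth a j).2); nra.
  by rewrite ler_norml => ? ?; apply/andP; split; lra.
have Im1 : `|tIm x a| <= 1.
  have : 2 * tIm x a <= tsqn x + tsqn a.
    rewrite sumE mulr_sumr; apply: ler_sum => j _.
    have := sqr_ge0 ((tnth x j).2 - (tnth a j).1).
    have := sqr_ge0 ((tnth x j).1 + (tnth a j).2); nra.
  have : - 2 * tIm x a <= tsqn x + tsqn a.
    rewrite sumE mulr_sumr; apply: ler_sum => j _.
    have := sqr_ge0 ((tnth x j).2 + (tnth a j).1).
    have := sqr_ge0 ((tnth x j).1 - (tnth a j).2); nra.
  by rewrite ler_norml => ? ?; apply/andP; split; lra.
have -> : 3 = Num.sqrt (3 ^+ 2) :> R by rewrite sqrtr_sqr ger0_norm.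
apply: ler_wsqrtr; rewrite /tdist2.
move: Re1 Im1; rewrite !ler_norml => /andP[? ?] /andP[? ?]; nra.
Qed.

End distance_bounds.

Lemma coord_ballE n (x : n.-tuple (plane R)) : @coord_ball R n x = (tsqn x < 1) :> Prop.
Proof.
rewrite /coord_ball/= /unit_ball/= -sqr_enorm_cpoint; congr is_true.
by rewrite expr_lt1// enorm_ge0.
Qed.

Lemma measurable_coord_ball n : measurable (@coord_ball R n).
Proof.
rewrite (_ : @coord_ball R n = [set x | tsqn x < 1]).
  by apply: measurable_ltset => //; exact: measurable_tsqn.
by apply/funext => x; rewrite coord_ballE.
Qed.

(** The factor c is the part of the integrand that depends on f and r; K depends
    on neither of them, nor on a. *)
Lemma kernel_integral n (e g : R) : 0 <= e -> 0 < g -> n.+1%:R < e + g ->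
  exists2 K : R, 0 < K & forall (a : n.+1.-tuple (plane R)) (c : R)
      (f : n.+1.-tuple (plane R) -> R),
    tsqn a < 1 -> 0 <= c ->
    (forall x, tsqn x < 1 -> 0 <= f x <=
       c * ((1 - tsqn x) `^ e * ((1 - tsqn a) * (1 - tsqn x) / tdist2 x a) `^ g
         / (1 - tsqn x) ^+ n.+2)) ->
  (\int[dV R n.+1]_(x in @coord_ball R n.+1) (f x)%:E <= (K * c)%:E)%E.
Proof.
move=> e0 g0 ng; have [C C0 volC] := volume_nonisoball R n.
pose N := e + g - n.+1%:R; have N0 : 0 < N by rewrite /N subr_gt0.
pose K0 := 2 * 2 `^ N * 16 `^ g * 12 `^ e.
have K00 : 0 < K0 by rewrite !mulr_gt0 ?powR_gt0.
pose X : R := 2^-1 `^ g; pose Y : R := 2^-1 `^ N.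
have lt1 (u : R) : 0 < u -> 0 <= 2^-1 `^ u < 1.
  move=> u0; rewrite powR_ge0/=.
  have := @gt0_ltr_powR R u u0 2^-1 1; rewrite powR1 !nnegrE; apply => //; lra.
have /andP[X0 X1] : 0 <= X < 1 := lt1 _ g0.
have /andP[Y0 Y1] : 0 <= Y < 1 := lt1 _ N0.
pose c0 : R := (fine (volume R n.+1 (@coord_ball R n.+1)))^-1.
have c00 : 0 <= c0 by rewrite invr_ge0; exact: fine_ge0.
pose K1 := K0 * c0 * C.
have K10 : 0 <= K1 by rewrite !mulr_ge0// ltW.
(* 1 is added only to make the constant positive. *)
exists (K1 / (1 - Y) / (1 - X) + 1).
  by rewrite ltr_wpDl// !divr_ge0// subr_ge0 ltW.
move=> a c f a1 c1 fP.
apply: (@le_trans _ _ (K1 * c / (1 - Y) / (1 - X))%:E); last first.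
  by rewrite lee_fin mulrDl mul1r -!(mulrAC _ c) lerDl.
pose del := 1 - tsqn a; have del0 : 0 < del by rewrite subr_gt0.
pose h l := del * 2 ^+ l; pose k l i := 2 * h l / 2 ^+ i.
have h0 l : 0 < h l by rewrite mulr_gt0 ?exprn_gt0.
have k0 l i : 0 < k l i by rewrite !mulr_gt0 ?invr_gt0 ?exprn_gt0.
pose w l i := c * K0 * X ^+ l * Y ^+ i / (h l ^+ n.+1 * k l i).
have w0 l i : 0 <= w l i.
  by rewrite !mulr_ge0 ?invr_ge0 ?exprn_ge0// ?ltW// mulr_gt0 ?exprn_gt0.
apply: (@integral_le_double_cover _ _ _ (dV R n.+1) _ f
         (fun l i => nonisoball a (h l) (k l i)) w (K1 * c) X Y) => //.
- exact: measurable_coord_ball.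
- by move=> l i; exact: measurable_nonisoball.
- exact: mulr_ge0.
- by rewrite X0.
- by rewrite Y0.
- by move=> x; rewrite coord_ballE => /fP/andP[].
- move=> x; rewrite coord_ballE => x1.
  have rho0 : 0 < 1 - tsqn x by rewrite subr_gt0.
  have Dge := tdist2_ge x a.
  pose D := Num.sqrt (tdist2 x a).
  have D0 : 0 < D by rewrite /D; lra.
  have D2 : D ^+ 2 = tdist2 x a by rewrite sqr_sqrtr// addr_ge0 ?sqr_ge0.
  have [|||l [i /= [Dh rk ker]]] :=
    @kernel_dyadic n.+1 e g (1 - tsqn x) del D g0 e0 ng rho0 del0 D0.
  + by rewrite /D; lra.
  + by rewrite /D /del; lra.
  + exact: tdist2_le.
  exists l, i; split; first split => //.
    by rewrite -D2 ltr_sqr// nnegrE ltW// h0.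
  have /andP[_ fx] := fP x x1; apply: le_trans fx _.
  have := ler_wpM2l c1 ker; rewrite -D2 => /le_trans; apply.
  by rewrite /w !mulrA.
move=> l i.
have k2h : k l i <= 2 * h l.
  rewrite /k ler_pdivrMr ?exprn_gt0//; apply: ler_peMr.
    by rewrite mulr_ge0// ltW.
  by rewrite exprn_ege1// ler1n.
have := volC a (h l) (k l i) a1 (h0 l) (k0 l i) k2h => V.
rewrite (_ : dV R n.+1 _ = c0%:E * volume R n.+1 (nonisoball a (h l) (k l i)))%E//.
rewrite muleA -EFinM.
apply: (le_trans (lee_wpmul2l _ V)); first by rewrite lee_fin mulr_ge0.
rewrite -EFinM lee_fin le_eqVlt; apply/orP; left; apply/eqP.
rewrite /w /K1.
have hk : h l ^+ n.+1 * k l i != 0 by rewrite gt_eqF// mulr_gt0 ?exprn_gt0.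
move: (h l ^+ n.+1 * k l i) hk => u u0; field.
exact: u0.
Qed.

End kernel_bound.

(** * Norms of dilates *)

Section norm_bound.
Variable R : realType.

Lemma powR_div (x y u : R) : 0 <= x -> 0 < y -> (x / y) `^ u = x `^ u / y `^ u.
Proof.
move=> x0 y0; have y1 := ltW y0; rewrite powRM ?invr_ge0//; congr (_ * _).
by rewrite -powR_inv1// -powRrM mulN1r powRN.
Qed.

(** Here rho / W <= 1, so its q-th power is at most its e-th power, which in turn
    is at most (rho / t)^e. *)
Lemma growth_dilate_weight (A M rho W t p q e : R) :
    0 <= A -> 0 < rho -> rho <= W -> 0 < t -> t <= W -> 1 <= p ->
    0 <= e -> e <= q -> A * W `^ (q / p) <= M ->
  A `^ p * rho `^ q <= M `^ p / t `^ e * rho `^ e.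
Proof.
move=> A0 rho0 rhoW t0 tW p1 e0 eq AM.
have W0 : 0 < W by exact: lt_le_trans rhoW.
have p0 : 0 < p by lra.
have q0 : 0 <= q by lra.
have rho1 := ltW rho0.
have M0 : 0 <= M by apply: le_trans AM; rewrite mulr_ge0// powR_ge0.
have AW : A `^ p * W `^ q <= M `^ p.
  have -> : W `^ q = (W `^ (q / p)) `^ p by rewrite -powRrM mulfVK// gt_eqF.
  rewrite -powRM ?powR_ge0//; apply: ge0_ler_powR; rewrite ?nnegrE//.
  - exact: ltW.
  - by rewrite mulr_ge0 ?powR_ge0.
apply: (@le_trans _ _ (M `^ p * (rho / W) `^ q)).
  rewrite powR_div// [leRHS](_ : _ = M `^ p / W `^ q * rho `^ q); last by ring.
  by apply: ler_wpM2r; rewrite ?powR_ge0// ler_pdivlMr// powR_gt0.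
rewrite -mulrA; apply: ler_wpM2l; first exact: powR_ge0.
have rW : 0 < rho / W <= 1 by rewrite divr_gt0//= ler_pdivrMr// mul1r.
apply: le_trans (ger_powR rW eq) _; rewrite powR_div// mulrC.
apply: ler_wpM2r; first exact: powR_ge0.
rewrite lef_pV2 ?posrE ?powR_gt0//; apply: ge0_ler_powR; rewrite ?nnegrE//; exact: ltW.
Qed.

Lemma N_integral_dilate_le n (p q s e : R) :
    1 <= p -> 0 <= e -> e <= q -> 0 < s -> n.+1%:R < e + n.+1%:R * s ->
  exists2 K : R, 0 < K & forall (r M : R) (f : 'rV[R[i]]_n.+1 -> R[i]) a,
    0 <= r -> r < 1 -> (growth_norm (q / p) f <= M%:E)%E -> unit_ball a ->
  (N_integral p q s (dilate r f) a <= (K * (M `^ p / (1 - r ^+ 2) `^ e))%:E)%E.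
Proof.
move=> p1 e0 eq s0 ns.
have g0 : 0 < n.+1%:R * s by rewrite mulr_gt0.
have [K K0 HK] := kernel_integral e0 g0 ns.
exists K => // r M f a r0 r1 fM a1.
have [b ab] := cpoint_surj a.
have b1 : tsqn b < 1.
  by rewrite -sqr_enorm_cpoint -ab expr_lt1// enorm_ge0.
have t0 : 0 < 1 - r ^+ 2 by rewrite subr_gt0 expr_lt1.
apply: (HK b) => //; first by rewrite divr_ge0 ?powR_ge0.
move=> x x1; set z := cpoint x.
have z1 : enorm z < 1 by rewrite -(@expr_lt1 _ 2)// ?enorm_ge0// sqr_enorm_cpoint.
have rho0 : 0 < 1 - tsqn x by rewrite subr_gt0.
have del0 : 0 < 1 - tsqn b by rewrite subr_gt0.
rewrite sqr_enorm_cpoint; apply/andP; split.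
  apply: divr_ge0; last by rewrite exprn_ge0// ltW.
  by rewrite !mulr_ge0 ?powR_ge0.
have D20 : 0 < tdist2 x b.
  have := tdist2_ge x b => H.
  have : 0 < Num.sqrt (tdist2 x b) by lra.
  by rewrite sqrtr_gt0.
have za : cdot z a != 1.
  apply: contraTneq D20 => za.
  by rewrite -sqr_normc_one_sub_cdot -ab za subrr Normc.normc0 expr0n ltxx.
rewrite one_sub_sqr_Phi// ab sqr_normc_one_sub_cdot !sqr_enorm_cpoint.
rewrite [leRHS]mulrA; apply: ler_wpM2r; first by rewrite invr_ge0 exprn_ge0// ltW.
rewrite [leRHS]mulrA.
apply: ler_wpM2r; first exact: powR_ge0.
set w := (r%:C)%C *: z.
have rr : 0 <= tsqn x * (1 - r ^+ 2) by rewrite mulr_ge0 ?tsqn_ge0 ?ltW.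
have r2 : 0 <= r ^+ 2 by exact: sqr_ge0.
have wE : 1 - enorm w ^+ 2 = 1 - r ^+ 2 * tsqn x.
  rewrite enormZ exprMn sqr_enorm_cpoint; congr (1 - _ * _).
  by rewrite sqr_normc_ReIm expr0n addr0.
apply: (@growth_dilate_weight _ _ _ (1 - r ^+ 2 * tsqn x)) => //.
- exact: normc_ge0.
- lra.
- nra.
rewrite -wE -lee_fin; apply: le_trans fM; apply: ereal_sup_ubound; exists w => //.
rewrite /unit_ball/= -(@expr_lt1 _ 2)// ?enorm_ge0//.
rewrite -subr_gt0 wE; lra.
Qed.

Lemma N_integral_ge0 n (p q s : R) (f : 'rV[R[i]]_n -> R[i]) a :
  (0 <= N_integral p q s f a)%E.
Proof.
apply: integral_ge0 => x x1; rewrite lee_fin; apply: divr_ge0.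
  by rewrite !mulr_ge0 ?powR_ge0.
rewrite exprn_ge0// subr_ge0 expr_le1 ?enorm_ge0//.
exact: ltW.
Qed.

Lemma unit_ball0 n : @unit_ball R n 0.
Proof.
rewrite /unit_ball/= -(@expr_lt1 _ 2)// ?enorm_ge0// sqr_enorm big1// => j _.
by rewrite mxE Normc.normc0 expr0n.
Qed.

Lemma growth_norm_ge0 n (l : R) (f : 'rV[R[i]]_n -> R[i]) :
  (0 <= growth_norm l f)%E.
Proof.
apply: le_ereal_sup_tmp; eexists; first by exists 0; [exact: unit_ball0|].
by rewrite lee_fin mulr_ge0 ?powR_ge0 ?normc_ge0.
Qed.

(** Exponents e are traded against powers of 1 - r^2: the smaller e is, the better
    the bound, but integrability near the sphere requires e + n s > n, where n is the dimension. *)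
Lemma N_norm_dilate_le n (p q s e : R) :
    1 <= p -> 0 <= e -> e <= q -> 0 < s -> n.+1%:R < e + n.+1%:R * s ->
  exists2 C : R, 0 < C & forall (r : R) (f : 'rV[R[i]]_n.+1 -> R[i]),
    0 <= r -> r < 1 ->
  (N_norm p q s (dilate r f) <=
     C%:E * growth_norm (q / p) f * (1 / (1 - r ^+ 2) `^ (e / p))%:E)%E.
Proof.
move=> p1 e0 eq s0 ns.
have [K K0 HK] := N_integral_dilate_le p1 e0 eq s0 ns.
have p0 : 0 < p by lra.
exists (K `^ p^-1); first exact: powR_gt0.
move=> r f r0 r1.
have t0 : 0 < 1 - r ^+ 2 by rewrite subr_gt0 expr_lt1.
have gr0 := growth_norm_ge0 (q / p) f.
move: (HK r ^~ f); case: (growth_norm (q / p) f) gr0 => [M| |] //; last first.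
  move=> _ _; rewrite gt0_muley ?lte_fin ?powR_gt0// gt0_mulye ?leey//.
  by rewrite lte_fin mul1r invr_gt0 powR_gt0.
rewrite lee_fin => M0 /(_ M _ r0 r1 (lexx _)) HM.
have pM : 0 <= M `^ p / (1 - r ^+ 2) `^ e by rewrite divr_ge0 ?powR_ge0.
have supM : (ereal_sup [set N_integral p q s (dilate r f) a | a in @unit_ball R n.+1]
    <= (K * (M `^ p / (1 - r ^+ 2) `^ e))%:E)%E.
  by apply: ge_ereal_sup => _ [a a1 <-]; exact: HM.
rewrite /N_norm.
apply: (@le_trans _ _ (((K * (M `^ p / (1 - r ^+ 2) `^ e))%:E) `^ p^-1)%E).
  apply: gt0_ler_poweR => //; rewrite ?invr_ge0 ?ltW// in_itv/= ?leey ?andbT.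
    apply: le_ereal_sup_tmp; exists (N_integral p q s (dilate r f) 0).
      by exists 0 => //; exact: unit_ball0.
    exact: N_integral_ge0.
  by rewrite lee_fin mulr_ge0// ltW.
have K0W := ltW K0; have pM0 : 0 < p^-1 by rewrite invr_gt0.
rewrite poweR_EFin -!EFinM lee_fin powRM//.
rewrite -[leRHS]mulrA; apply: ler_wpM2l.
  exact: powR_ge0.
have pp : p * p^-1 = 1 by rewrite mulfV// gt_eqF.
rewrite powR_div ?powR_gt0 ?powR_ge0//.
rewrite -!powRrM pp powRr1//.
by rewrite mul1r.
Qed.

End norm_bound.

Unset Implicit Arguments.

Theorem theorem5p9 (R : realType) (n : nat) (p q s : R) :
  (0 < n)%N -> 1 <= p -> 0 < q -> Num.max 0 (1 - q / n%:R) < s ->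
  exists C : R, 0 < C /\
    forall (r : R) (f : 'rV[R[i]]_n -> R[i]),
      0 <= r -> r < 1 -> holomorphic f ->
      (1 < s ->
        (N_norm p q s (dilate r f) <=
           C%:E * growth_norm (q / p) f
             * (1 / (1 - r ^+ 2) `^ (q / p))%:E)%E) /\
      (s <= 1 ->
        (N_norm p q s (dilate r f) <=
           C%:E * growth_norm (q / p) f
             * (1 / (1 - r ^+ 2) `^ (2 * (n.+1%:R - n%:R * s) / p))%:E)%E).
Proof.
case: n => // n _ p1 q0; rewrite gt_max => /andP[s0 qs].
have n0 : 0 < n.+1%:R :> R by rewrite ltr0n.
have nqs : n.+1%:R < q + n.+1%:R * s.
  move: qs; rewrite ltrBlDr -ltrBlDl ltr_pdivlMr//; lra.
have p0 : 0 < p by lra.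
have [s1|s1] := ltP 1 s.
  have [C C0 HC] := N_norm_dilate_le p1 (ltW q0) (lexx q) s0 nqs.
  exists C; split => // r f r0 r1 _; split=> // _; exact: HC.
(* At most q, to weaken (rho / W)^q, and at most E, for the power of 1 - r^2. *)
pose E := 2 * (n.+2%:R - n.+1%:R * s).
have nn : n.+2%:R = n.+1%:R + 1 :> R by rewrite -natr1.
have ns1 : n.+1%:R * s <= n.+1%:R by rewrite ler_piMr// ltW.
have E0 : 0 < E by rewrite /E nn; lra.
pose e := Num.min q E.
have e0 : 0 <= e by rewrite /e le_min !ltW.
have eq : e <= q by rewrite /e ge_min lexx.
have eE : e <= E by rewrite /e ge_min lexx orbT.
have nes : n.+1%:R < e + n.+1%:R * s.
  by rewrite -ltrBlDr /e lt_min; apply/andP; split; rewrite /E ?nn; lra.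
have [C C0 HC] := N_norm_dilate_le p1 e0 eq s0 nes.
exists C; split => // r f r0 r1 _; split => // _.
apply: le_trans (HC r f r0 r1) _.
have t0 : 0 < 1 - r ^+ 2 by rewrite subr_gt0 expr_lt1.
apply: lee_wpmul2l.
  by apply: mule_ge0; [rewrite lee_fin ltW|exact: growth_norm_ge0].
rewrite lee_fin !mul1r lef_pV2 ?posrE ?powR_gt0//; apply: ger_powR.
  by rewrite t0 gerBl sqr_ge0.
by rewrite ler_pM2r ?invr_gt0.
Qed.
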